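(* Up to isomorphism, the non-trivial $2$-dimensional real unital algebras are exactly the following three algebras, given by their matrices of structure constants (MSC): $$A_{2,r}\left(\tfrac{1}{2},0,\tfrac{1}{2}\right)=\left(\begin{array}{cccc}\frac{1}{2} & 0 & 0 & 1\\ 0 & \frac{1}{2} & \frac{1}{2} & 0\end{array}\right),\qquad A_{3,r}\left(\tfrac{1}{2},0,\tfrac{1}{2}\right)=\left(\begin{array}{cccc}\frac{1}{2} & 0 & 0 & -1\\ 0 & \frac{1}{2} & \frac{1}{2} & 0\end{array}\right),$$ $$A_{5,r}\left(\tfrac{1}{2},\tfrac{1}{2}\right)=\left(\begin{array}{cccc}\frac{1}{2} & 0 & 0 & 0\\ 0 & \frac{1}{2} & \frac{1}{2} & 0\end{array}\right).$$
   Context: A real algebra is a vector space $\mathbb{A}$ over $\mathbb{R}$ with a bilinear multiplication (not assumed associative or commutative). It is non-trivial if its multiplication is not identically zero. For a $2$-dimensional algebra with basis $(e_1,e_2)$, its matrix of structure constants (MSC) is the $2\times 4$ real matrix $A=\left(\begin{array}{cccc}\alpha_1&\alpha_2&\alpha_3&\alpha_4\\ \beta_1&\beta_2&\beta_3&\beta_4\end{array}\right)$ with $e_1e_1=\alpha_1e_1+\beta_1e_2$, $e_1e_2=\alpha_2e_1+\beta_2e_2$, $e_2e_1=\alpha_3e_1+\beta_3e_2$, $e_2e_2=\alpha_4e_1+\beta_4e_2$. An algebra is identified with its MSC. Two algebras with MSCs $A$ and $B$ are isomorphic iff $B=gA(g^{-1})^{\otimes 2}$ for some $g\in GL(2;\mathbb{R})$,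 with $\otimes$ the Kronecker product. An algebra $\mathbb{A}$ is unital if there is an element $\mathbf{1}\in\mathbb{A}$ with $\mathbf{1}\cdot\mathbf{u}=\mathbf{u}\cdot\mathbf{1}=\mathbf{u}$ for all $\mathbf{u}\in\mathbb{A}$. The symbols $A_{i,r}(\cdot)$ are just names for the displayed matrices. *)

(* Defs.v *)
From HB Require Import structures.
From mathcomp Require Export all_boot all_order all_algebra.
From mathcomp Require Export mxtens reals.

Set Implicit Arguments.
Unset Strict Implicit.
Unset Printing Implicit Defensive.

Import GRing.Theory.
Local Open Scope ring_scope.

Definition nontrivial (R : realType) (V : lmodType R) (mul : V -> V -> V) :=
  exists x y : V, mul x y <> 0.

Definition unital (R : realType) (V : lmodType R) (mul : V -> V -> V) :=
  exists one : V, forall u : V, mul one u = u /\ mul u one = u.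

(* Column k of the MSC holds the coordinates of e_i e_j, where k = 2 i + j
   (indices from 0): the columns are e1 e1, e1 e2, e2 e1, e2 e2. This is the
   order in which *t enumerates pairs of indices. *)
Definition msc (R : realType) (V : vectType R) (e : 2.-tuple V)
    (mul : V -> V -> V) : 'M[R]_(2, 4) :=
  \matrix_(i, k) coord e i (mul e`_(k %/ 2)%N e`_(k %% 2)%N).

(* The algebra on R^2 (column vectors, canonical basis) whose MSC is A. *)
Definition msc_mul (R : realType) (A : 'M[R]_(2, 4)) (x y : 'cV[R]_2) :
    'cV[R]_2 :=
  A *m (x *t y).

Definition msc_isom (R : realType) (A B : 'M[R]_(2, 4)) :=
  exists2 g : 'M[R]_2, g \in unitmx & B = g *m A *m (invmx g *t invmx g).

Definition mx24 (R : realType) (rows : seq (seq R)) : 'M[R]_(2, 4) :=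
  \matrix_(i, j) nth 0 (nth [::] rows i) j.

(* A_{2,r}(1/2, 0, 1/2), A_{3,r}(1/2, 0, 1/2) and A_{5,r}(1/2, 1/2). *)
Definition A2r (R : realType) : 'M[R]_(2, 4) :=
  mx24 [:: [:: 1 / 2; 0;     0;     1];
           [:: 0;     1 / 2; 1 / 2; 0]].

Definition A3r (R : realType) : 'M[R]_(2, 4) :=
  mx24 [:: [:: 1 / 2; 0;     0;    -1];
           [:: 0;     1 / 2; 1 / 2; 0]].

Definition A5r (R : realType) : 'M[R]_(2, 4) :=
  mx24 [:: [:: 1 / 2; 0;     0;     0];
           [:: 0;     1 / 2; 1 / 2; 0]].

Fact msc_mul_bilinear (R : realType) (A : 'M[R]_(2, 4)) :
  bilinear_for (GRing.Scale.Law.clone _ _ *:%R _)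
               (GRing.Scale.Law.clone _ _ *:%R _) (msc_mul A).
Proof.
split=> u a x y; rewrite /= /msc_mul scalemxAr -mulmxDr; congr (_ *m _);
  apply/matrixP=> i j; rewrite !mxE.
  by rewrite mulrDl mulrA.
by rewrite mulrDr mulrCA.
Qed.

HB.instance Definition _ (R : realType) (A : 'M[R]_(2, 4)) :=
  bilinear_isBilinear.Build R 'cV[R]_2 'cV[R]_2 'cV[R]_2 *:%R *:%R
    (msc_mul A) (msc_mul_bilinear A).

(* Main.v *)
Require Import Defs.
From mathcomp Require Import ring lra.
Set Implicit Arguments.
Unset Strict Implicit.
Unset Printing Implicit Defensive.

Import Order.TTheory GRing.Theory Num.Theory.
Local Open Scope ring_scope.

(* A 2-dimensional unital algebra has a basis (1/2, w) with w w = s (1/2): take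
   any v outside the line of 1, write v v = a v + b 1, and complete the square
   with w = v - (a/2) 1. Rescaling w multiplies s by a nonzero square, so that
   s can be taken in {1, -1, 0}. Conversely an isomorphism between two such
   tables maps 1/2 to itself, hence changes s by a nonzero square only. *)

(** At [s = 1], [-1], [0] this unfolds to [A2r], [A3r], [A5r], so facts about [sqr_msc] apply to
    them directly. *)
Definition sqr_msc (R : realType) (s : R) : 'M[R]_(2, 4) :=
  mx24 [:: [:: 1 / 2; 0;     0;     s];
           [:: 0;     1 / 2; 1 / 2; 0]].

Lemma col2P (R : realType) (x y : 'cV[R]_2) :
  x ord0 0 = y ord0 0 -> x ord_max 0 = y ord_max 0 -> x = y.
Proof.
move=> x0 x1; apply/matrixP=> i j; rewrite (ord1 j).
by case: i => -[|[|//]] i2; [move: x0 | move: x1]; congr (x _ _ = y _ _);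
  apply: val_inj.
Qed.

Lemma sum_mxtens (V : nmodType) (m n : nat) (F : 'I_(m * n) -> V) :
  \sum_(k < m * n) F k = \sum_(i < m) \sum_(j < n) F (mxtens_index (i, j)).
Proof.
rewrite pair_bigA (reindex (@mxtens_index m n)) /=; first by apply: eq_bigr => -[].
by exists (@mxtens_unindex m n) => k _; [apply: mxtens_indexK | apply: mxtens_unindexK].
Qed.

Lemma sum_ord2 (V : nmodType) (F : 'I_2 -> V) :
  \sum_(k < 2) F k = F ord0 + F ord_max.
Proof.
rewrite !big_ord_recl big_ord0 addr0.
by congr (F _ + F _); apply: val_inj.
Qed.

(* The type of A makes the inner dimension of the product 4, which is only
   convertible to the 2 * 2 that tensmxE rewrites with. *)
Lemma mulmx_tensE (R : realType) (A : 'M[R]_(2, 4)) (n m : nat)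
    (x : 'M[R]_(2, n)) (y : 'M[R]_(2, m)) (k : 'I_2) (i : 'I_n) (j : 'I_m) :
  (A *m (x *t y)) k (mxtens_index (i, j)) =
  \sum_(a < 2) \sum_(b < 2) A k (mxtens_index (a, b)) * (x a i * y b j).
Proof.
rewrite mxE (@sum_mxtens _ 2 2); apply: eq_bigr => a _; apply: eq_bigr => b _.
congr (_ * _); exact: tensmxE.
Qed.

(** Arbitrary numbers of columns serve two uses: column vectors give the product of the algebra, and
    [x = y = p] gives the isomorphism equations. *)
Lemma sqr_msc_mul_tens (R : realType) (s : R) (n m : nat)
    (x : 'M[R]_(2, n)) (y : 'M[R]_(2, m)) (i : 'I_n) (j : 'I_m) :
  ((sqr_msc s *m (x *t y)) ord0 (mxtens_index (i, j)) =
     x ord0 i * y ord0 j / 2 + s * x ord_max i * y ord_max j)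
  * ((sqr_msc s *m (x *t y)) ord_max (mxtens_index (i, j)) =
     (x ord0 i * y ord_max j + x ord_max i * y ord0 j) / 2).
Proof.
split; rewrite mulmx_tensE !sum_ord2 !mxE /=; by field.
Qed.

Lemma sqr_msc_mulE (R : realType) (s : R) (x y : 'cV[R]_2) :
  (msc_mul (sqr_msc s) x y ord0 0 =
     x ord0 0 * y ord0 0 / 2 + s * x ord_max 0 * y ord_max 0)
  * (msc_mul (sqr_msc s) x y ord_max 0 =
     (x ord0 0 * y ord_max 0 + x ord_max 0 * y ord0 0) / 2).
Proof.
have := sqr_msc_mul_tens s x y 0 0.
by have -> : mxtens_index (0 : 'I_1, 0 : 'I_1) = 0 by apply: val_inj.
Qed.

Lemma sqr_msc_unital (R : realType) (s : R) : unital (msc_mul (sqr_msc s)).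
Proof.
(* The first basis vector is half of the identity. *)
exists (\col_i (if i == ord0 then 2 else 0)) => u.
split; apply: col2P; rewrite sqr_msc_mulE !mxE /=; by field.
Qed.

Lemma unital_nontrivial (R : realType) (V : lmodType R) (mul : V -> V -> V) :
  (exists v : V, v <> 0) -> unital mul -> nontrivial mul.
Proof. by move=> [v v0] [one oneP]; exists one, v; rewrite (oneP v).1. Qed.

Lemma sqr_msc_nontrivial (R : realType) (s : R) :
  nontrivial (msc_mul (sqr_msc s)).
Proof.
apply: unital_nontrivial (sqr_msc_unital s); exists (const_mx 1) => /matrixP.
by move=> /(_ ord0 0); rewrite !mxE; apply/eqP; rewrite oner_eq0.
Qed.

(** With [p] the inverse of [g], the condition becomes polynomial in the entries of [p]. *)
Lemma msc_isomP (R : realType) (A B : 'M[R]_(2, 4)) :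
  msc_isom A B <->
  exists2 p : 'M[R]_2, p \in unitmx & p *m B = A *m (p *t p).
Proof.
split=> [[g gu ->] | [p pu pB]].
  by exists (invmx g); rewrite ?unitmx_inv // -!mulmxA mulKmx.
exists (invmx p); rewrite ?unitmx_inv // invmxK -mulmxA -pB mulKmx //.
Qed.

Lemma sqr_msc_isom (R : realType) (s t : R) :
  msc_isom (sqr_msc s) (sqr_msc t) -> exists2 d : R, d != 0 & t = s * d ^+ 2.
Proof.
move=> /msc_isomP[p pu /matrixP pE].
have E0 (i j : 'I_2) := etrans (pE ord0 (@mxtens_index 2 2 (i, j)))
  (sqr_msc_mul_tens s p p i j).1.
have E1 (i j : 'I_2) := etrans (pE ord_max (@mxtens_index 2 2 (i, j)))
  (sqr_msc_mul_tens s p p i j).2.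
move: pu; rewrite unitmxE unitfE (expand_det_row _ ord0) sum_ord2 /cofactor !det_mx11 !mxE /= expr0 expr1.
have -> : lift ord0 0 = ord_max :> 'I_2 by apply: val_inj.
have -> : lift ord_max 0 = ord0 :> 'I_2 by apply: val_inj.
move: (E0 ord0 ord0) (E1 ord0 ord0).
move: (E0 ord0 ord_max) (E1 ord0 ord_max).
move: (E0 ord_max ord_max) (E1 ord_max ord_max).
rewrite !mxE !sum_ord2 !mxE /= => {E0 E1 pE}.
move: (p ord0 ord0) (p ord0 ord_max) (p ord_max ord0) (p ord_max ord_max).
(* The columns of [p] are [(a, c)] and [(b, d)]; in each [h], the first digit is the column of the
   MSC and the second is the row. *)
move=> a b c d h30 h31 h10 h11 h00 h01 det.
(* [h01] reads [c / 2 = a * c]. If [c] were nonzero, then [a = 1 / 2], and [h11] would give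
   [a * d = b * c], a zero determinant. *)
have c0 : c = 0.
  apply/eqP; apply: contraNT det => c0.
  have a2 : a = 1 / 2 by apply: (mulIf c0); lra.
  by move: h11; rewrite a2 => h11; apply/eqP; lra.
move: det h30 h31 h10 h11 h00; rewrite {}c0 => det h30 h31 h10 h11 h00.
have a0 : a != 0 by apply: contraNneq det => ->; apply/eqP; ring.
have d0 : d != 0 by apply: contraNneq det => ->; apply/eqP; ring.
(* Now [h00] reads [a = a ^+ 2], [h31] reads [b * d = 0], and [h30] becomes [t = s * d ^+ 2]. *)
have a1 : a = 1 by apply: (mulfI a0); lra.
have b0 : b = 0 by apply: (mulIf d0); lra.
by exists d => //; move: h30; rewrite a1 b0 => h30; lra.
Qed.

Lemma mscE (R : realType) (V : vectType R) (e : 2.-tuple V)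
    (mul : V -> V -> V) (i a b : 'I_2) :
  msc e mul i (mxtens_index (a, b)) = coord e i (mul e`_a e`_b).
Proof.
rewrite mxE; congr (coord e i (mul e`_ _ e`_ _)).
  by rewrite /= divnMDl // divn_small ?addn0.
by rewrite /= modnMDl modn_small.
Qed.

(** The columns of [p] are the coordinates of [f] in [e]; both sides of the equation in [msc_isomP]
    then list the coordinates in [e] of the products of vectors of [f]. *)
Lemma msc_basis_isom (R : realType) (V : vectType R)
    (mul : {bilinear V -> V -> V}) (e f : 2.-tuple V) :
  basis_of {:V} e -> basis_of {:V} f -> msc_isom (msc e mul) (msc f mul).
Proof.
move=> be bf; apply/msc_isomP.
pose p : 'M[R]_2 := \matrix_(i, j) coord e i f`_j.
have fE (j : 'I_2) : f`_j = \sum_i p i j *: e`_i.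
  rewrite (coord_basis be (memvf f`_j)).
  by apply: eq_bigr => i _; rewrite mxE.
exists p.
  have : p *m (\matrix_(i, j) coord f i e`_j) = 1%:M.
    apply/matrixP=> i j; rewrite !mxE eq_sym -(coord_free j i (basis_free be)).
    rewrite [in RHS](coord_basis bf (memvf e`_j)) linear_sum.
    by apply: eq_bigr => k _; rewrite !mxE linearZ mulrC.
  by case/mulmx1_unit.
apply/matrixP=> i k; case: (@mxtens_indexP 2 2 k) => a b.
transitivity (coord e i (mul f`_a f`_b)).
  rewrite mxE (coord_basis bf (memvf (mul f`_a f`_b))) linear_sum.
  by apply: eq_bigr => l _; rewrite mscE mxE linearZ mulrC.
apply: etrans (esym (mulmx_tensE (msc e mul) p p i a b)).
rewrite !fE linear_sumlz linear_sum.
apply: eq_bigr => c _; rewrite linear_sumr linear_sum; apply: eq_bigr => d _.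
rewrite mscE linearZl_LR linearZr_LR !linearZ /=; ring.
Qed.

Lemma msc_sqr (R : realType) (V : vectType R) (mul : {bilinear V -> V -> V})
    (e : 2.-tuple V) (s : R) :
  free e ->
  mul e`_0 e`_0 = 2^-1 *: e`_0 -> mul e`_0 e`_1 = 2^-1 *: e`_1 ->
  mul e`_1 e`_0 = 2^-1 *: e`_1 -> mul e`_1 e`_1 = s *: e`_0 ->
  msc e mul = sqr_msc s.
Proof.
move=> fe m00 m01 m10 m11; apply/matrixP=> i k.
case: (@mxtens_indexP 2 2 k) => a b.
have c0 j : coord e j e`_0 = (0 == j :> nat)%:R := coord_free ord0 j fe.
have c1 j : coord e j e`_1 = (1 == j :> nat)%:R := coord_free ord_max j fe.
rewrite mscE mxE; case: i => [[|[|//]] i2]; case: a => [[|[|//]] a2];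
  case: b => [[|[|//]] b2] /=; rewrite ?m00 ?m01 ?m10 ?m11 linearZ /= ?c0 ?c1 /=;
  ring.
Qed.

(** The scalar [s] is fixed before [r], so that its sign can decide the rescaling. *)
Lemma unital_sqr_basis (R : realType) (V : vectType R)
    (mul : {bilinear V -> V -> V}) :
  \dim {:V} = 2%N -> unital mul ->
  exists s : R, forall r : R, r != 0 ->
    exists2 e : 2.-tuple V, basis_of {:V} e & msc e mul = sqr_msc (s * r ^+ 2).
Proof.
move=> dimV [one oneP].
have one0 : one != 0.
  apply/eqP => one0; suff V0 : ({:V} <= 0)%VS.
    by move: (dimvS V0); rewrite dimV dimv0.
  apply/subvP=> u _; rewrite memv0; apply/eqP.
  by rewrite -(oneP u).1 one0 linear0l.
have /subvPn[v _ v1] : ~~ ({:V} <= <[one]>)%VS.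
  by apply/negP => /dimvS; rewrite dimV dim_vline one0.
have bv : basis_of {:V} [tuple v; one].
  by rewrite basisEfree free_cons span_seq1 v1 seq1_free one0 subvf dimV.
have := coord_basis bv (memvf (mul v v)); rewrite sum_ord2 /=.
move: (coord _ _ _) (coord _ _ _) => b a vv.
pose w := v - (a / 2) *: one.
have ww : mul w w = (b + a ^+ 2 / 4) *: one.
  rewrite /w !(linearBl, linearBr, linearZl_LR, linearZr_LR) /=.
  rewrite (oneP v).1 (oneP v).2 (oneP one).1 vv.
  have -> : a *: v = (a / 2) *: v + (a / 2) *: v.
    by rewrite -scalerDl; congr (_ *: _); field.
  move: ((a / 2) *: v) => x; rewrite opprB [x + x + _]addrAC addrK [x + _]addrC.
  rewrite addrACA subrr addr0 scalerA -scalerDl; congr (_ *: _); by field.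
(* The factor 2 expresses [mul w w] in terms of half the identity. *)
exists (2 * (b + a ^+ 2 / 4)) => r r0.
pose e := [tuple 2^-1 *: one; r *: w].
have be : basis_of {:V} e.
  have pe : perm_eq e [:: r *: w; 2^-1 *: one] by rewrite (perm_catC [:: _] [:: _]).
  rewrite (perm_basis _ pe) basisEfree subvf dimV free_cons seq1_free span_seq1.
  rewrite scaler_eq0 invr_eq0 pnatr_eq0 (negPf one0) !andbT.
  (* If [r *: w] were [k / 2] times [one], then [v], which is [w + (a / 2) *: one], would lie on the
     line of [one]. *)
  apply: contra v1 => /vlineP[k rw]; apply/vlineP.
  exists (r^-1 * k / 2 + a / 2).
  rewrite scalerDl -[LHS](subrK ((a / 2) *: one)) -/w; congr (_ + _).
  by rewrite -!scalerA -rw scalerA mulVf ?scale1r.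
exists e => //; apply: msc_sqr (basis_free be) _ _ _ _ => /=;
  rewrite !(linearZl_LR, linearZr_LR) /= ?(oneP _).1 ?(oneP _).2 ?ww //.
- by rewrite !scalerA mulrC.
- rewrite !scalerA; congr (_ *: _); by field.
Qed.

Theorem corollary5p4 (R : realType) :
  [/\ (* the three algebras are non-trivial and unital *)
      [/\ nontrivial (msc_mul (A2r R)) /\ unital (msc_mul (A2r R)),
          nontrivial (msc_mul (A3r R)) /\ unital (msc_mul (A3r R))
        & nontrivial (msc_mul (A5r R)) /\ unital (msc_mul (A5r R))],
      (* every non-trivial 2-dimensional unital algebra is isomorphic to one
         of them *)
      forall (V : vectType R) (mul : {bilinear V -> V -> V}),
        \dim {:V} = 2%N -> nontrivial mul -> unital mul ->
        forall e : 2.-tuple V, basis_of {:V} e ->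
          [\/ msc_isom (msc e mul) (A2r R),
              msc_isom (msc e mul) (A3r R)
            | msc_isom (msc e mul) (A5r R)]
    & (* no two of them are isomorphic *)
      [/\ ~ msc_isom (A2r R) (A3r R),
          ~ msc_isom (A2r R) (A5r R)
        & ~ msc_isom (A3r R) (A5r R)]].
Proof.
split.
- by split; split; do [exact: sqr_msc_nontrivial | exact: sqr_msc_unital].
- move=> V mul dimV _ umul e be; have [s sP] := unital_sqr_basis dimV umul.
  have isomP (r t : R) : r != 0 -> s * r ^+ 2 = t ->
      msc_isom (msc e mul) (sqr_msc t).
    by move=> /sP[f bf fE] <-; rewrite -fE; exact: msc_basis_isom.
  have [s0|s0|s0] := ltgtP s 0.
  + apply: Or32; apply: (isomP (Num.sqrt (- s))^-1).
      by rewrite invr_eq0 sqrtr_eq0 -ltNge oppr_gt0.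
    rewrite exprVn sqr_sqrtr ?oppr_ge0 ?ltW // invrN mulrN divff ?lt_eqF //.
  + apply: Or31; apply: (isomP (Num.sqrt s)^-1).
      by rewrite invr_eq0 sqrtr_eq0 -ltNge.
    by rewrite exprVn sqr_sqrtr ?divff ?gt_eqF // ltW.
  + by apply: Or33; apply: (isomP 1); rewrite ?oner_eq0 // s0 mul0r.
(* For a nonzero [d], the three cases would require [-1 = d ^+ 2], [0 = d ^+ 2] and
   [0 = - d ^+ 2]. *)
- split=> /sqr_msc_isom[d d0] /eqP; apply/negP.
  + by rewrite mul1r lt_eqF // (lt_le_trans _ (sqr_ge0 d)) // ltrN10.
  + by rewrite mul1r eq_sym sqrf_eq0.
  + by rewrite mulN1r eq_sym oppr_eq0 sqrf_eq0.
Qed.
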